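(* Let $S$, $\Pi_1$, $U$, $\Delta$, $sw$, $U_T$, $\mathbf{W}$, $\mathcal{P}$, $I$ and $M(S)$ be as in the context, and suppose that $|\Pi_1|$ is odd and $3\leq |\Pi_1|\leq n-3$. For $1\le i\le 4$ put $$A_i:=\{j\in[n]~|~j\equiv i \text{ or } j\equiv n+|\Pi_1|-i \pmod{4}\}.$$ Then the nontrivial orbits of $F_2^n$ under $\mathbf{W}$ are $U_{A_1}, U_{A_2}, U_{A_3}, U_{A_4}$ (some of these may coincide). In particular, the number of orbits (including the trivial orbit $\{0\}$) is $$|\mathcal{P}|=\begin{cases}3, & \text{if } n \text{ is even};\\ 4, & \text{if } n \text{ is odd},\end{cases}$$ and $$M(S)=\begin{cases}1, & \text{if } A_i\cap I\neq\emptyset \text{ for all } 1\le i\le 4;\\ 2, & \text{otherwise.}\end{cases}$$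
   Context: $S$ is a finite simple connected graph with vertex set $\{s_1,\dots,s_n\}$, $n\ge 2$, and edge set $R$, such that $s_1,s_2,\dots,s_{n-1}$ is an induced path ($s_i\sim s_{i+1}$ and no other edges among $s_1,\dots,s_{n-1}$). The neighbours of $s_n$ are $s_{j_1},\dots,s_{j_m}$ with $1\le j_1<\dots<j_m\le n-1$. Vectors in $F_2^n$ (column vectors over the two-element field) have coordinates indexed by the vertices. For a vertex $s$, $\widetilde{s}$ is its characteristic vector. For each vertex $s$ the flipping move $\mathbf{s}\in \mathrm{Mat}_n(F_2)$ has entries $\mathbf{s}_{ab}=1$ if $a=b$, or if $b=s$ and $ab\in R$, and $\mathbf{s}_{ab}=0$ otherwise. Thus $\mathbf{s}\widetilde{b}=\widetilde{b}$ for $b\ne s$, and $\mathbf{s}\widetilde{s}=\widetilde{s}+\sum_{a:\,as\in R}\widetilde{a}$. The flipping group $\mathbf{W}$ is the subgroup of $\mathrm{GL}_n(F_2)$ generated by $\mathbf{s_1},\dots,\mathbf{s_n}$. It acts on $F_2^n$ by left multiplication, and its orbits are exactly the equivalence classes of the lit-only flipping puzzle on $S$. $\mathcal{P}$ denotes the set of these orbits; $\{0\}$ is the trivial orbit. Define $\overline{1}=\widetilde{s}_1$ and $\overline{i+1}=\mathbf{s_i}\mathbf{s_{i-1}}\cdots\mathbf{s_1}\overline{1}$ for $1\le i\le n-1$. Set $\Pi=\{\overline{1},\dots,\overline{n}\}$, $\Pi_0=\{\overline{i}\in\Pi:\langle\overline{i},\widetilde{s}_n\rangle=0\}$ (standard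 dot product over $F_2$), and $\Pi_1=\Pi\setminus\Pi_0$. For $0\le i\le n$ let $[\overline{i}]=\{\overline{1},\dots,\overline{i}\}$, with $[\overline{0}]=\emptyset$. $U$ is the span of $\Pi$; when $|\Pi_1|$ is odd, $U=F_2^n$. $\Delta=\Pi$ when $|\Pi_1|$ is odd; this is a basis of $F_2^n$. For $u\in F_2^n$, $\Delta(u)$ is the unique subset of $\Delta$ with $u=\sum_{x\in\Delta(u)}x$, and the simple weight is $sw(u)=|\Delta(u)|$. For $V\subseteq F_2^n$ and $T\subseteq\{0,\dots,n\}$, $V_T=\{u\in V: sw(u)\in T\}$. $[n]=\{1,\dots,n\}$. $w(u)$ is the Hamming weight of $u$. For $O\in\mathcal{P}$, $w(O)=\min_{u\in O}w(u)$, and $M(S)=\max_{O\in\mathcal{P}}w(O)$. When $|\Pi_1|$ is odd, $I=\{i\in[n]: |[\overline{i}]\cap\Pi_1| \text{ is even, or } i=n, \text{ or } |[\overline{n-i}]\cap\Pi_1| \text{ is odd}\}$. *)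

(* Defs.v *)
From mathcomp Require Import all_boot all_order all_fingroup all_algebra.

Set Implicit Arguments.
Unset Strict Implicit.
Unset Printing Implicit Defensive.

Import GRing.Theory.
Local Open Scope ring_scope.

(* The number of vertices is n = n'.+1, so that 'GL_n(F_2) is available, and
   the vertex set is 'I_n'.+1; a graph is given by its adjacency relation. *)

Definition simple_graph (T : finType) (e : rel T) : Prop :=
  symmetric e /\ irreflexive e.

Definition connected_graph (T : finType) (e : rel T) : Prop :=
  forall x y, connect e x y.

(* The vertex s_k, meaningful for 1 <= k <= n (0-based index k - 1). *)
Definition vtx (n' k : nat) : 'I_n'.+1 := inord k.-1.

(* s_1, ..., s_(n-1) is an induced path. *)
Definition induced_path (n' : nat) (e : rel 'I_n'.+1) : Prop :=
  forall i j : nat, (1 <= i)%N -> (i < j)%N -> (j <= n')%N ->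
    e (vtx n' i) (vtx n' j) = (j == i.+1).

Definition tilde (n' : nat) (s : 'I_n'.+1) : 'cV['F_2]_n'.+1 :=
  \col_a (a == s)%:R.

Definition dot (n' : nat) (u v : 'cV['F_2]_n'.+1) : 'F_2 := (u^T *m v) 0 0.

Section LitOnly.

Variables (n' : nat) (e : rel 'I_n'.+1).
Local Notation n := n'.+1.
Local Notation vec := ('cV['F_2]_n).

Definition flip (s : 'I_n) : 'M['F_2]_n :=
  \matrix_(a, b) ((a == b) || ((b == s) && e a b))%:R.

(* Every flipping move of a loopless graph is invertible, so the generating set
   of [flipping_group] below contains all of them. *)
Lemma flip_unitmx (s : 'I_n) : irreflexive e -> flip s \in unitmx.
Proof.
move=> irr.
suff /mulmx1_unit[] : flip s *m flip s = 1%:M by [].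
have flipE : flip s = 1%:M + \matrix_(a, b) ((b == s) && e a b)%:R.
  apply/matrixP=> a b; rewrite !mxE; case: eqP => [->|_] /=.
    by case: eqP => [->|_]; rewrite ?irr /= addr0.
  by rewrite add0r.
set N := \matrix_(a, b) _ in flipE.
have NN0 : N *m N = 0.
  apply/matrixP=> a b; rewrite !mxE big1 // => c _; rewrite !mxE.
  case: (c =P s) => [->|_]; last by rewrite mul0r.
  by case: (b =P s) => [->|_] /=; rewrite ?irr mulr0.
rewrite flipE mulmxDl !mulmxDr NN0 !mul1mx mulmx1 addr0 -addrA.
suff -> : N + N = 0 by rewrite addr0.
by apply/matrixP=> a b; rewrite !mxE; case: (_ && _); apply/val_inj.
Qed.

Definition flipping_group : {group {'GL_n['F_2]}} :=
  <<[set g : {'GL_n['F_2]} | [exists s, GLval g == flip s]]>>%G.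

Definition flip_orbit (u : vec) : {set vec} :=
  [set GLval g *m u | g : {'GL_n['F_2]} in flipping_group].

Definition orbits : {set {set vec}} := [set flip_orbit u | u in [set: vec]].

(* bar i is the vector overlined i: bar 1 is the characteristic vector of s_1,
   and bar (i + 1) = s_i s_(i-1) ... s_1 (bar 1). *)
Definition bar (i : nat) : vec :=
  foldl (fun v k => flip (vtx n' k) *m v) (tilde (vtx n' 1)) (iota 1 i.-1).

Definition prefix_set (i : nat) : {set vec} := [set:: map bar (iota 1 i)].

Definition Pi : {set vec} := prefix_set n.
Definition Pi0 : {set vec} := [set x in Pi | dot x (tilde (vtx n' n)) == 0].
Definition Pi1 : {set vec} := Pi :\: Pi0.

Definition Uspan : {set vec} := [set u | u \in <<enum Pi>>%VS].

(* This is the basis of F_2^n used when #|Pi1| is odd. *)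
Definition Delta : {set vec} := Pi.

(* The subset of Delta whose sum is u; it exists and is unique when Delta is
   a basis (set0 is an arbitrary default). *)
Definition Delta_of (u : vec) : {set vec} :=
  odflt set0 [pick D : {set vec} | (D \subset Delta) && (u == \sum_(x in D) x)].

Definition sw (u : vec) : nat := #|Delta_of u|.

(* V_T *)
Definition weight_part (V : {set vec}) (T : seq nat) : {set vec} :=
  [set u in V | sw u \in T].

(* Finite subsets of nat are given as sequences.  The subtraction does not
   truncate in the range of interest, i <= 4 and 3 <= #|Pi1|, 6 <= n. *)
Definition Aset (i : nat) : seq nat :=
  [seq j <- iota 1 n | (j == i %[mod 4]) || (j == n + #|Pi1| - i %[mod 4])].

Definition Iset : seq nat :=
  [seq i <- iota 1 n | [|| ~~ odd #|prefix_set i :&: Pi1|, i == n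
                         | odd #|prefix_set (n - i) :&: Pi1|]].

Definition hamming (u : vec) : nat := #|[set a | u a 0 != 0]|.

(* The default n is harmless: weights are at most n and orbits are nonempty. *)
Definition orbit_weight (O : {set vec}) : nat :=
  \big[minn/n]_(u in O) hamming u.

Definition max_orbit_weight : nat := \max_(O in orbits) orbit_weight O.

End LitOnly.

(* Main.v *)
Require Import Defs.
From mathcomp Require Import all_boot all_order all_fingroup all_algebra zify.

Set Implicit Arguments.
Unset Strict Implicit.
Unset Printing Implicit Defensive.

Import GRing.Theory.
Local Open Scope ring_scope.

(* The vector bar (i + 1) = barvec i has path part
   tilde s_i + tilde s_(i+1) (with the missing end terms dropped), and its s_n
   coordinate is the parity hubpar i.  When the set hubset of indices with odd
   parity has odd size, the barvec i form a basis, so a vector is a subset D of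
   the indices (barsum D), and its simple weight is #|D|.  In this model the
   flip at s_i, i < n, is the transposition of two consecutive indices, and the
   flip at s_n replaces D by its symmetric difference with ~: hubset when
   #|D :&: hubset| is odd.  Hence every orbit is a union of size classes, and the last
   flip sends a size w to n - p + 2k - w, where p = #|hubset| and k is odd; this
   links exactly the sizes w and w' with w = w' or w + w' = n + p modulo 4.
   For the weights, the sum of the first k barvec's is tilde s_k plus possibly
   tilde s_n, so every size is realized by a vector of Hamming weight at most
   2, while the sizes of the vectors tilde s_k are exactly the elements of I. *)

(** * Arithmetic in ['F_2] and a counting fact *)

Lemma natr_F2 (k : nat) : k%:R = (odd k)%:R :> 'F_2.
Proof. by apply: val_inj; rewrite /= !val_Fp_nat // !modn2; case: (odd k). Qed.

Lemma addb_F2 (x y : bool) : (x (+) y)%:R = x%:R + y%:R :> 'F_2.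
Proof. by case: x y => [] [] //; apply: val_inj. Qed.

Lemma addrr_F2 (m n : nat) (v : 'M['F_2]_(m, n)) : v + v = 0.
Proof.
by apply/matrixP=> a b; rewrite !mxE -mulr2n -mulr_natr natr_F2 mulr0.
Qed.

Lemma boolr_F2_inj (x y : bool) : x%:R = y%:R :> 'F_2 -> x = y.
Proof. by case: x y => [] [] // /(congr1 val). Qed.

Lemma subset_of_card (T : finType) (A : {set T}) (k : nat) :
  (k <= #|A|)%N -> exists2 D : {set T}, D \subset A & #|D| = k.
Proof.
rewrite -bin_gt0 -cards_draws card_gt0 => /set0Pn[D]; rewrite inE => /andP[DA /eqP].
by exists D.
Qed.

(** * Orbits of the flipping group of a loopless graph *)

Section FlipOrbits.

Variables (n' : nat) (e : rel 'I_n'.+1).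
Hypothesis e_irr : irreflexive e.

Lemma flip_mul (s : 'I_n'.+1) (v : 'cV['F_2]_n'.+1) :
  flip e s *m v = v + v s 0 *: \col_a (e a s)%:R.
Proof.
apply/colP=> a; rewrite !mxE (bigD1 a) //= mxE eqxx mul1r; congr (_ + _).
have [->|ne_as] := eqVneq s a.
  rewrite e_irr mulr0 big1 // => b /negPf neb.
  by rewrite mxE eq_sym neb /= mul0r.
rewrite (bigD1 s) //= mxE (eq_sym a) (negPf ne_as) eqxx /= mulrC big1 ?addr0 // => b.
by case/andP=> /negPf nba /negPf nbs; rewrite mxE eq_sym nba nbs mul0r.
Qed.

Lemma flip_orbit_refl (u : 'cV['F_2]_n'.+1) : u \in flip_orbit e u.
Proof. by apply/imsetP; exists 1%g; rewrite ?group1 ?GL_1E ?mul1mx. Qed.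

Lemma flip_orbit_sym (u v : 'cV['F_2]_n'.+1) :
  v \in flip_orbit e u -> u \in flip_orbit e v.
Proof.
case/imsetP=> g gW ->; apply/imsetP; exists g^-1%g; first by rewrite groupV.
by rewrite GL_VxE mulKmx // GL_unitmx.
Qed.

Lemma flip_orbit_trans (u v w : 'cV['F_2]_n'.+1) :
  v \in flip_orbit e u -> w \in flip_orbit e v -> w \in flip_orbit e u.
Proof.
case/imsetP=> g gW -> /imsetP[h hW ->]; apply/imsetP; exists (h * g)%g.
  exact: groupM.
by rewrite GL_MxE mulmxA.
Qed.

Lemma flip_in_orbit (s : 'I_n'.+1) (u : 'cV['F_2]_n'.+1) :
  flip e s *m u \in flip_orbit e u.
Proof.
apply/imsetP; exists (Sub (flip e s) (flip_unitmx s e_irr)); last by rewrite SubK.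
by apply: mem_gen; rewrite inE; apply/existsP; exists s; rewrite SubK.
Qed.

(** The group is finite, so its elements are products of generators without inverses; closure of [X]
    under the single moves therefore suffices. *)
Lemma flip_orbit_sub (X : {set 'cV['F_2]_n'.+1}) (u : 'cV['F_2]_n'.+1) :
  (forall s v, v \in X -> flip e s *m v \in X) -> u \in X ->
  flip_orbit e u \subset X.
Proof.
move=> Xflip uX; apply/subsetP=> _ /imsetP[g /gen_prodgP[k [c cP ->]] ->].
elim: k c cP => [|k IHk] c cP; first by rewrite big_ord0 GL_1E mul1mx.
rewrite big_ord_recl GL_MxE -mulmxA.
have := cP ord0; rewrite inE => /existsP[s /eqP->].
by apply: Xflip; apply: IHk => i; apply: cP.
Qed.

End FlipOrbits.

(** * The vectors [barvec] and the effect of the moves on their sums *)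

Section PathBasis.

Variables (n' : nat) (e : rel 'I_n'.+1).
Hypotheses (n'_gt1 : (1 < n')%N) (e_simple : simple_graph e).
Hypothesis (e_path : induced_path e).
Local Notation n := n'.+1.
Local Notation vec := 'cV['F_2]_n.

Let e_irr : irreflexive e. Proof. by case: e_simple. Qed.
Let e_sym : symmetric e. Proof. by case: e_simple. Qed.

Lemma path_adj (a b : 'I_n) : (a < n')%N -> (b < n')%N ->
  e a b = (a.+1 == b :> nat) || (b.+1 == a :> nat).
Proof.
have lt_adj (x y : 'I_n) : (x < y)%N -> (y < n')%N -> e x y = (x.+1 == y :> nat).
  move=> xy yn; rewrite -[e x y](_ : e (vtx n' x.+1) (vtx n' y.+1) = _).
    by rewrite e_path // eqSS eq_sym.
  by rewrite /vtx /= !inord_val.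
move=> an bn; case: (ltngtP a b) => [ab|ba|/val_inj->].
- by rewrite lt_adj //; lia.
- by rewrite e_sym lt_adj //; lia.
- by rewrite e_irr; lia.
Qed.

(* The parity of the number of neighbours of s_n among s_1, ..., s_i: the
   coordinate of bar (i + 1) at s_n. *)
Definition hubpar (i : nat) : bool := odd (\sum_(j < i) e (inord j) ord_max).

Lemma hubparS (i : nat) : hubpar i.+1 = hubpar i (+) e (inord i) ord_max.
Proof. by rewrite /hubpar big_ord_recr /= oddD oddb. Qed.

Definition barvec (i : nat) : vec :=
  \col_(a < n) (if (a < n')%N then (a == i :> nat) || (a.+1 == i) else hubpar i)%:R.

Lemma inord_path (i : nat) : (i < n')%N -> (inord i : 'I_n) = i :> nat.
Proof. by move=> lt_in; rewrite inordK // ltnS ltnW. Qed.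

Lemma hub_coord (a : 'I_n) : (a < n')%N = false -> a = ord_max.
Proof. by move=> an; apply: val_inj => /=; have := ltn_ord a; lia. Qed.

(** The common term tilde s_(i+1) cancels and leaves the path neighbours, while the parity at s_n
    changes exactly when s_(i+1) is adjacent to s_n. *)
Lemma barvec_col (i : nat) : (i < n')%N ->
  \col_a (e a (inord i))%:R = barvec i + barvec i.+1.
Proof.
move=> lt_in; apply/colP=> a; rewrite !mxE -addb_F2; congr (nat_of_bool _)%:R.
case: ifPn => [an|/negPf/hub_coord->].
  by rewrite path_adj ?inord_path //; lia.
by rewrite hubparS addKb e_sym.
Qed.

(** Only [barvec i] and [barvec i.+1] are nonzero at this vertex, and adding their sum to either one
    gives the other. *)
Lemma flip_barvec (i j : nat) : (i < n')%N ->
  flip e (inord i) *m barvec j =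
    barvec (if j == i then i.+1 else if j == i.+1 then i else j).
Proof.
move=> lt_in; rewrite flip_mul // mxE barvec_col // inord_path // lt_in.
have [->|ne_ji] := eqVneq j i; first by rewrite scale1r addrA addrr_F2 add0r.
have [->|ne_jSi] := eqVneq j i.+1.
  by rewrite orbT scale1r addrC -addrA addrr_F2 addr0.
by rewrite scale0r addr0.
Qed.

Lemma bar_barvec (i : nat) : (i <= n')%N -> bar e i.+1 = barvec i.
Proof.
elim: i => [_|i IHi lt_in].
  apply/colP=> a; rewrite !mxE /vtx /= -val_eqE /= inordK //; congr (nat_of_bool _)%:R.
  case: ifPn => [an|/negPf/hub_coord->]; first by rewrite orbF.
  by rewrite /hubpar big_ord0 /=; lia.
have -> : bar e i.+2 = flip e (vtx n' i.+1) *m bar e i.+1.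
  by rewrite /bar -[i.+2.-1]addn1 iotaD foldl_cat.
by rewrite IHi 1?ltnW // flip_barvec // eqxx.
Qed.

Lemma barvec_inj (i j : 'I_n) : barvec i = barvec j -> i = j.
Proof.
wlog lt_ij : i j / (i < j)%N => [hw eqb|/colP eqb].
  by case: (ltngtP i j) => [/hw->|/hw->|/val_inj].
have coord k : (k < n')%N ->
    (k == i :> nat) || (k.+1 == i) = (k == j :> nat) || (k.+1 == j).
  move=> kn; have := eqb (inord k); rewrite !mxE inord_path // kn.
  exact: boolr_F2_inj.
have := ltn_ord j; rewrite ltnS => le_jn.
(* Coordinate [i] forces [j = i + 1]; then coordinate 1 if [i = 0], and coordinate [i - 1]
   otherwise, tells the two vectors apart. *)
have := coord i (leq_trans lt_ij le_jn); rewrite eqxx /= => ij.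
have [i0|i_gt0] := posnP i; first by have := coord 1%N n'_gt1; lia.
by have := coord i.-1; lia.
Qed.

Definition hubset : {set 'I_n} := [set i : 'I_n | hubpar i].

Definition barsum (D : {set 'I_n}) : vec := \sum_(i in D) barvec (i : 'I_n).

(** Only [barvec a] and [barvec a.+1] are nonzero at a path vertex [a]. *)
Lemma barsum_path (D : {set 'I_n}) (a : 'I_n) : (a < n')%N ->
  barsum D a 0 = ((a \in D) (+) (inord a.+1 \in D))%:R.
Proof.
have sum_mem (b : 'I_n) : \sum_(i in D) (i == b)%:R = (b \in D)%:R :> 'F_2.
  have [bD|bD] := boolP (b \in D).
    by rewrite (bigD1 b) //= eqxx big1 ?addr0 // => i /andP[_ /negPf->].
  by rewrite big1 // => i iD; case: eqVneq iD bD => // -> ->.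
move=> an; rewrite addb_F2 -!sum_mem -big_split summxE /=.
apply: eq_bigr => i _; rewrite mxE an -addb_F2; congr (nat_of_bool _)%:R.
by rewrite -!val_eqE /= inordK //; lia.
Qed.

Lemma barsum_hub (D : {set 'I_n}) :
  barsum D ord_max 0 = (odd #|D :&: hubset|)%:R.
Proof.
rewrite -natr_F2 summxE -sum1_card natr_sum.
under [RHS]eq_bigl => i do rewrite inE.
rewrite [RHS]big_mkcondr /=; apply: eq_bigr => i _; rewrite mxE ltnn inE.
by case: hubpar.
Qed.

(** Initial segments represent the sizes and later give vectors of small Hamming weight. *)
Definition prefix (k : nat) : {set 'I_n} := [set i : 'I_n | (i < k)%N].

Lemma card_prefix (k : nat) : (k <= n)%N -> #|prefix k| = k.
Proof.
move=> le_kn; have -> : prefix k = [set widen_ord le_kn i | i in [set: 'I_k]].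
  apply/setP=> i; rewrite inE; apply/idP/imsetP => [lt_ik|[j _ ->] /=];
    last exact: ltn_ord.
  by exists (Ordinal lt_ik); rewrite ?inE //; apply: val_inj.
by rewrite card_imset ?cardsT ?card_ord // => i j /(congr1 val) /= /val_inj.
Qed.

Lemma barsum_flip_path (i : nat) (D : {set 'I_n}) : (i < n')%N ->
  flip e (inord i) *m barsum D = barsum (tperm (inord i) (inord i.+1) @: D).
Proof.
move=> lt_in; rewrite mulmx_sumr /barsum big_imset /=; last by move=> ? ? _ _ /perm_inj.
apply: eq_bigr => j _; rewrite flip_barvec //; congr barvec.
have iE := inord_path lt_in.
have SiE : (inord i.+1 : 'I_n) = i.+1 :> nat by rewrite inordK.
case: tpermP => [->|->|/eqP neji /eqP nejSi]; rewrite ?iE ?SiE ?eqxx //.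
  by rewrite gtn_eqF.
by move: neji nejSi; rewrite -!val_eqE /= iE SiE => /negPf-> /negPf->.
Qed.

Definition toggle (D : {set 'I_n}) : {set 'I_n} := D :&: hubset :|: ~: (D :|: hubset).

(** [hubpar] changes from [a] to [a.+1] exactly when the path vertex [a] is adjacent to s_n, and the
    s_n coordinate vanishes because [~: hubset] misses [hubset]. *)
Lemma barsum_setC_hubset : barsum (~: hubset) = \col_a (e a ord_max)%:R.
Proof.
apply/colP=> a; rewrite [RHS]mxE; case: (ltnP a n') => [an|na].
  rewrite barsum_path // !inE inordK // hubparS addbN addNb negbK addbA addbb.
  by rewrite inord_val.
have -> : a = ord_max by apply: hub_coord; rewrite ltnNge na.
by rewrite barsum_hub setIC setICr cards0 e_irr.
Qed.

Lemma barsum_flip_hub (D : {set 'I_n}) :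
  flip e ord_max *m barsum D =
    barsum (if odd #|D :&: hubset| then toggle D else D).
Proof.
rewrite flip_mul // barsum_hub -barsum_setC_hubset.
case: ifP => _; last by rewrite scale0r addr0.
(* The terms over [D :\: hubset] occur in both sums on the left and cancel. *)
rewrite scale1r /barsum (big_setID hubset) [in X in _ + X](big_setID D).
rewrite [RHS](big_setID hubset) /=.
rewrite (_ : ~: hubset :&: D = D :\: hubset) ?[LHS]addrA; last first.
  by rewrite setIC setDE.
rewrite -[X in X + _]addrA addrr_F2 addr0.
by congr (_ + _); apply: eq_bigl => i; rewrite !inE; case: (i \in D); case: (hubpar i).
Qed.

(** Induction on the sum of the indices: where [i] is missing and [i + 1] is present, a
    transposition lowers the sum; if this never happens, [D] is an initial segment. *)
Lemma barsum_orbit_prefix (D : {set 'I_n}) :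
  barsum (prefix #|D|) \in flip_orbit e (barsum D).
Proof.
have [m] := ubnP (\sum_(i in D) i); elim: m D => // m IHm D le_Dm.
have [/existsP[i /and3P[lt_in iD SiD]]|] :=
    boolP [exists i : 'I_n, [&& (i < n')%N, i \notin D & inord i.+1 \in D]]; last first.
  rewrite negb_exists => /forallP Ddown.
  have sub_prefix (k : nat) : (k < n)%N -> inord k \in D -> prefix k.+1 \subset D.
    elim: k => [|k IHk] lt_kn kD; apply/subsetP=> i; rewrite inE ltnS => le_ik.
      by rewrite (_ : i = inord 0) //; apply: val_inj; rewrite /= inordK; lia.
    have [i_eq|i_ne] := eqVneq (i : nat) k.+1; first by rewrite -[i]inord_val i_eq.
    have lt_kn' : (k < n')%N := lt_kn.
    have := Ddown (inord k); rewrite inord_path // lt_kn' kD andbT negbK => kD'.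
    by apply: (subsetP (IHk (ltnW lt_kn) kD')); rewrite inE; lia.
  suff <- : D = prefix #|D| by exact: flip_orbit_refl.
  have le_Dn : (#|D| <= n)%N by rewrite (leq_trans (max_card _)) ?card_ord.
  apply/eqP; rewrite eqEcard card_prefix // leqnn andbT.
  (* A member [i] of [D] puts [prefix i.+1] inside [D], hence [i < #|D|]. *)
  apply/subsetP=> i iD; rewrite inE -(card_prefix (ltn_ord i)).
  by apply: subset_leq_card; apply: sub_prefix => //; rewrite inord_val.
apply: flip_orbit_trans (flip_in_orbit e_irr (inord i) _) _.
rewrite barsum_flip_path // inord_val.
rewrite -(card_imset (mem D) (@perm_inj _ (tperm i (inord i.+1)))).
rewrite ltnS in le_Dm; apply: IHm; apply: leq_trans le_Dm.
rewrite big_imset /=; last by move=> ? ? _ _ /perm_inj.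
rewrite (bigD1 (inord i.+1)) // [in X in (_ < X)%N](bigD1 (inord i.+1)) //= tpermR.
rewrite inordK // addSn ltnS leq_add2l leq_sum // => j /andP[jD nej].
by rewrite tpermD // eq_sym //; apply: contraNneq iD => <-.
Qed.

Lemma barsum_orbit_card (D E : {set 'I_n}) : #|D| = #|E| ->
  barsum E \in flip_orbit e (barsum D).
Proof.
move=> eqDE; apply: flip_orbit_trans (barsum_orbit_prefix D) _.
by rewrite eqDE; apply/flip_orbit_sym/barsum_orbit_prefix.
Qed.

(** * [Pi], [Pi1] and the simple weight in terms of index sets *)

Lemma Pi_barvec : Pi e = [set barvec i | i : 'I_n].
Proof.
apply/setP=> u; rewrite inE; apply/mapP/imsetP => [[k]|[i _ ->]].
  rewrite mem_iota add1n ltnS => /andP[k_gt0 le_kn] ->.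
  by exists (inord k.-1) => //; rewrite inordK ?prednK // -bar_barvec ?prednK //; lia.
exists i.+1; first by rewrite mem_iota; have := ltn_ord i; lia.
by rewrite bar_barvec // -ltnS.
Qed.

Lemma dot_tilde (u : vec) (a : 'I_n) : dot u (tilde a) = u a 0.
Proof.
rewrite /dot mxE (bigD1 a) //= !mxE eqxx mulr1 big1 ?addr0 // => b /negPf neb.
by rewrite !mxE neb mulr0.
Qed.

Lemma Pi1_hubset : Pi1 e = [set barvec i | i : 'I_n in hubset].
Proof.
have hubE (i : 'I_n) : (dot (barvec i) (tilde (vtx n' n)) == 0) = ~~ hubpar i.
  by rewrite dot_tilde mxE /vtx /= inordK // ltnn; case: hubpar.
apply/setP=> u; rewrite /Pi1 /Pi0 Pi_barvec in_setD inE andbC.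
apply/andP/imsetP => [[/imsetP[i _ ->]]|[i iC ->]]; rewrite imset_f //= hubE negbK.
  by exists i; rewrite ?inE.
by rewrite inE in iC.
Qed.

Lemma card_Pi1 : #|Pi1 e| = #|hubset|.
Proof. by rewrite Pi1_hubset card_imset //; apply: barvec_inj. Qed.

Lemma card_prefix_set (k : nat) : (k <= n)%N ->
  #|prefix_set e k :&: Pi1 e| = #|prefix k :&: hubset|.
Proof.
move=> le_kn; rewrite Pi1_hubset.
have -> : prefix_set e k = [set barvec i | i : 'I_n in prefix k].
  apply/setP=> u; rewrite inE; apply/mapP/imsetP => [[j]|[i]].
    rewrite mem_iota add1n ltnS => /andP[j_gt0 le_jk] ->.
    have lt_jn : (j.-1 < n)%N by lia.
    exists (inord j.-1); first by rewrite inE inordK //; lia.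
    by rewrite inordK // -bar_barvec ?prednK //; lia.
  rewrite inE => lt_ik ->; exists i.+1; first by rewrite mem_iota; lia.
  by rewrite bar_barvec // -ltnS.
by rewrite -imsetI ?card_imset //; [exact: barvec_inj|move=> ? ? _ _; exact: barvec_inj].
Qed.
Hypothesis hub_odd : odd #|hubset|.

(** The path coordinates determine [D] up to complement, and the s_n coordinate separates
    complements because [#|hubset|] is odd. *)
Lemma barsum_inj : injective barsum.
Proof.
move=> D E eqDE; pose d (k : nat) : bool := (inord k \in D) (+) (inord k \in E).
have dE (a : 'I_n) : (a \in D) = d a (+) (a \in E) by rewrite /d inord_val addbK.
have d_const (k : nat) : (k < n)%N -> d k = d 0%N.
  elim: k => // k IHk lt_kn; rewrite -(IHk (ltnW lt_kn)).
  have kn : ((inord k : 'I_n) < n')%N by rewrite inord_path.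
  have := congr1 (fun u : vec => u (inord k) 0) eqDE.
  rewrite !barsum_path // inord_path // => /boolr_F2_inj; rewrite /d.
  by do 4!case: (_ \in _).
have := congr1 (fun u : vec => u ord_max 0) eqDE; rewrite !barsum_hub => /boolr_F2_inj.
have [d0|d0] := boolP (d 0%N); last first.
  by move=> _; apply/setP=> a; rewrite dE d_const // (negPf d0).
have -> : D = ~: E by apply/setP=> a; rewrite inE dE d_const // d0.
move=> eq_odd; move: hub_odd; rewrite -(cardsID E) oddD setIC -eq_odd.
by rewrite setDE (setIC hubset) addbb.
Qed.

(** Injectivity suffices: there are [2 ^ n] index sets and [2 ^ n] vectors. *)
Lemma barsum_surj (u : vec) : exists D, u = barsum D.
Proof.
have /codomP[D ->] : u \in codom barsum; last by exists D.
apply: inj_card_onto barsum_inj _ _.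
rewrite card_mx card_Fp // muln1.
by rewrite -[#|{set _}|]cardsT -powersetT card_powerset cardsT card_ord.
Qed.

Lemma Uspan_setT : Uspan e = [set: vec].
Proof.
apply/setP=> u; rewrite !inE; have [D ->] := barsum_surj u.
by apply: memv_suml => i _; rewrite memv_span // mem_enum Pi_barvec imset_f.
Qed.

Lemma sum_barvec (D : {set 'I_n}) :
  \sum_(x in [set barvec i | i : 'I_n in D]) x = barsum D.
Proof. by rewrite big_imset // => i j _ _; apply: barvec_inj. Qed.

(** The image of [D] is a candidate, so the default of the pick is never reached; any picked set is
    the image of an index set, which [barsum_inj] identifies with [D]. *)
Lemma sw_barsum (D : {set 'I_n}) : sw e (barsum D) = #|D|.
Proof.
rewrite /sw /Delta_of; case: pickP => [X /andP[]|
    /(_ [set barvec i | i : 'I_n in D])]; last first.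
  rewrite sum_barvec eqxx andbT => /negP[]; apply/subsetP=> _ /imsetP[i _ ->].
  by rewrite /Delta Pi_barvec imset_f.
rewrite /Delta Pi_barvec => X_Pi; pose E : {set 'I_n} := [set i : 'I_n | barvec i \in X].
have -> : X = [set barvec i | i : 'I_n in E].
  apply/setP=> u; apply/idP/imsetP=> [uX|[i]]; last by rewrite inE => ? ->.
  by have /imsetP[i _ uE] := subsetP X_Pi u uX; exists i; rewrite // inE -uE.
rewrite sum_barvec => /eqP/barsum_inj <-.
by rewrite card_imset //; apply: barvec_inj.
Qed.

Lemma barsum0 : barsum set0 = 0.
Proof. by rewrite /barsum big_set0. Qed.

Lemma in_weight_part (T : seq nat) (D : {set 'I_n}) :
  (barsum D \in weight_part e (Uspan e) T) = (#|D| \in T).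
Proof. by rewrite inE Uspan_setT inE sw_barsum. Qed.

(** * Sizes linked by the moves *)

(** Each index outside [hubset] lies in exactly one of [D] and [toggle D], and each index of
    [hubset] in both or neither. *)
Lemma card_toggle (D : {set 'I_n}) :
  (#|toggle D| + #|D| = #|~: hubset| + 2 * #|D :&: hubset|)%N.
Proof.
rewrite -(cardsID hubset (toggle D)) -(cardsID hubset D) -(cardsID D (~: hubset)).
have -> : toggle D :&: hubset = D :&: hubset.
  by apply/setP=> i; rewrite !inE; case: (i \in D); case: hubpar.
have -> : toggle D :\: hubset = ~: hubset :\: D.
  by apply/setP=> i; rewrite !inE; case: (i \in D); case: hubpar.
have -> : ~: hubset :&: D = D :\: hubset by rewrite setIC setDE.
lia.
Qed.

Local Notation p := #|hubset|.

Lemma card_setC_hubset : (#|~: hubset| = n - p)%N.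
Proof. by rewrite cardsCs setCK card_ord. Qed.

(** The bounds on [k] allow [D] to be replaced by a set of the same size with exactly [k] elements
    in [hubset]; as [k] is odd, the move at s_n toggles it. *)
Lemma toggle_orbit (w k : nat) (D E : {set 'I_n}) :
  odd k -> (k <= p)%N -> (k <= w)%N -> (w - k <= n - p)%N ->
  #|D| = w -> #|E| = (n - p + 2 * k - w)%N -> barsum E \in flip_orbit e (barsum D).
Proof.
move=> k_odd le_kp le_kw le_wkq cardD cardE.
have [X sXh cardX] := subset_of_card le_kp.
have [Y sYh cardY] : exists2 Y : {set 'I_n}, Y \subset ~: hubset & #|Y| = (w - k)%N.
  by apply: subset_of_card; rewrite card_setC_hubset.
have Yh : Y :&: hubset = set0 by apply: disjoint_setI0; rewrite disjoints_subset.
have XYh : (X :|: Y) :&: hubset = X by rewrite setIUl (setIidPl sXh) Yh setU0.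
have cardXY : #|X :|: Y| = w.
  have : X :&: Y \subset Y :&: hubset by rewrite setIC setIS.
  rewrite Yh subset0 => /eqP XY0.
  by rewrite cardsU XY0 cards0 subn0 cardX cardY subnKC.
have XY_D : barsum (X :|: Y) \in flip_orbit e (barsum D).
  by apply: barsum_orbit_card; rewrite cardXY.
apply: flip_orbit_trans XY_D (flip_orbit_trans (flip_in_orbit e_irr ord_max _) _).
rewrite barsum_flip_hub XYh cardX k_odd; apply: barsum_orbit_card.
have := card_toggle (X :|: Y); rewrite XYh cardXY cardX card_setC_hubset cardE; lia.
Qed.

Hypotheses (p_ge3 : (3 <= p)%N) (p_le : (p <= n - 3)%N).

(* The sets of sizes w and w + 4 are linked through any size v for which
   toggling is possible with both k and k + 2 hub elements. *)
Lemma orbit_add4 (w : nat) (D E : {set 'I_n}) : (0 < w)%N ->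
  #|D| = w -> #|E| = (w + 4)%N -> barsum E \in flip_orbit e (barsum D).
Proof.
move=> w_gt0 cardD cardE.
have le_wn : (w + 4 <= n)%N by rewrite -cardE (leq_trans (max_card _)) ?card_ord.
have [k [k_odd le_kp le_kw le_wk]] :
    exists k, [/\ odd k, k + 2 <= p, k <= w & w + 2 <= n - p + k]%N.
  (* The witness is the largest odd [k] with [k + 2 <= p] and [k <= w]; the last bound follows from
     [w + 4 <= n] in the first case and from [3 <= n - p] in the second. *)
  have [le_pw|lt_wp] := leqP p (w + 2); first by exists (p - 2)%N; split; lia.
  by exists (if odd w then w else w.-1); case: ifP; split; lia.
have [le_vn cardF] : (n - p + 2 * k - w <= n)%N /\
    #|prefix (n - p + 2 * k - w)| = (n - p + 2 * k - w)%N.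
  have le : (n - p + 2 * k - w <= n)%N by lia.
  by rewrite card_prefix.
apply: (flip_orbit_trans (v := barsum (prefix (n - p + 2 * k - w)))).
  by apply/flip_orbit_sym/(toggle_orbit k_odd _ _ _ cardF); lia.
by apply: (@toggle_orbit _ (k + 2) _ _ _ _ _ _ cardF); lia.
Qed.

Lemma orbit_mod4 (D E : {set 'I_n}) : (0 < #|D|)%N -> (0 < #|E|)%N ->
  #|D| = #|E| %[mod 4] -> barsum E \in flip_orbit e (barsum D).
Proof.
wlog le_DE : D E / (#|D| <= #|E|)%N => [hw|D_gt0 _ /eqP].
  case: (leqP #|D| #|E|) => [/hw//|/ltnW /hw {}hw] D0 E0 DE.
  by apply: flip_orbit_sym; apply: hw.
rewrite eq_sym eqn_mod_dvd // => /dvdnP[m /eqP].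
rewrite -(eqn_add2r #|D|) subnK // => /eqP.
elim: m E {le_DE} => [|m IHm] E cardE; first by apply: barsum_orbit_card; rewrite cardE.
have le_En : (#|E| <= n)%N by rewrite (leq_trans (max_card _)) ?card_ord.
have cardF : #|prefix (m * 4 + #|D|)| = (m * 4 + #|D|)%N by rewrite card_prefix; lia.
apply: flip_orbit_trans (IHm _ cardF) _.
by apply: (orbit_add4 _ cardF); lia.
Qed.

(** In the second case, a size [w] from 1 to 4 is toggled with [k = 1]. Since [p] is odd, [2 - p]
    and [p] agree modulo 4, so the new size [n - p + 2 - w] is congruent to [#|E|]. *)
Lemma orbit_class (D E : {set 'I_n}) : (0 < #|D|)%N -> (0 < #|E|)%N ->
  (#|D| == #|E| %[mod 4]) || (#|D| + #|E| == n + p %[mod 4]) ->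
  barsum E \in flip_orbit e (barsum D).
Proof.
move=> D0 E0 /orP[/eqP|DE]; first exact: orbit_mod4.
have [w [w_gt0 w_le4 wD]] : exists w, [/\ 0 < w, w <= 4 & w = #|D| %[mod 4]]%N.
  (* Residue 0 is represented by 4, since the empty set is an orbit of its own. *)
  by exists (if #|D| %% 4 == 0 then 4 else #|D| %% 4)%N; case: ifP; split; lia.
have cardF : #|prefix w| = w by rewrite card_prefix; lia.
have cardG : #|prefix (n - p + 2 * 1 - w)| = (n - p + 2 * 1 - w)%N.
  by rewrite card_prefix; lia.
apply: (flip_orbit_trans (v := barsum (prefix w))); first by apply: orbit_mod4; lia.
apply: (flip_orbit_trans (v := barsum (prefix (n - p + 2 * 1 - w)))).
  by apply: (toggle_orbit _ _ _ _ cardF cardG); lia.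
by apply: orbit_mod4; lia.
Qed.

(** * The classes given by [Aset] as orbits *)

(** Here [i <= n + p], so the truncated subtraction can be moved across the congruence, which makes
    it symmetric in [i] and [j]. *)
Lemma mem_Aset (i j : nat) : (i <= 4)%N ->
  (j \in Aset e i) =
    [&& 0 < j, j <= n & (j == i %[mod 4]) || (i + j == n + p %[mod 4])]%N.
Proof. by move=> i4; rewrite mem_filter mem_iota card_Pi1; lia. Qed.

(** Path moves keep the size. A toggle gives two sizes with sum [n - p + 2 * k], [k] odd, which is
    [n + p] modulo 4; this exchanges the two residues allowed in [Aset e i]. *)
Lemma flip_weight_part (i : nat) (s : 'I_n) (u : vec) : (i <= 4)%N ->
  u \in weight_part e (Uspan e) (Aset e i) ->
  flip e s *m u \in weight_part e (Uspan e) (Aset e i).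
Proof.
move=> i4; have [D ->] := barsum_surj u; rewrite in_weight_part => D_Ai.
have [sn|sn] := ltnP s n'.
  rewrite -[s]inord_val barsum_flip_path // in_weight_part card_imset //.
  exact: perm_inj.
have -> : s = ord_max by apply: hub_coord; rewrite ltnNge sn.
rewrite barsum_flip_hub in_weight_part; case: ifP => // oddD.
have := card_toggle D; rewrite card_setC_hubset; move: D_Ai; rewrite !mem_Aset //.
(* An intersection of odd size is nonempty, so the toggled set has positive size. *)
have : (#|D :&: hubset| <= #|toggle D|)%N by apply: subset_leq_card; apply: subsetUl.
have : (#|toggle D| <= n)%N by rewrite (leq_trans (max_card _)) ?card_ord.
by move: oddD hub_odd p_le; lia.
Qed.

Lemma flip_orbit_class (i : nat) (D : {set 'I_n}) : (i <= 4)%N -> #|D| \in Aset e i ->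
  flip_orbit e (barsum D) = weight_part e (Uspan e) (Aset e i).
Proof.
move=> i4 D_Ai; apply/eqP; rewrite eqEsubset; apply/andP; split.
  by apply: flip_orbit_sub => [s v|]; [exact: flip_weight_part|rewrite in_weight_part].
apply/subsetP=> u; have [E ->] := barsum_surj u; rewrite in_weight_part.
move: D_Ai; rewrite !mem_Aset // => /and3P[D0 Dn Di] /and3P[E0 En Ei].
by apply: orbit_class => //; lia.
Qed.

Lemma weight_part_orbit (i : nat) : (0 < i <= 4)%N ->
  weight_part e (Uspan e) (Aset e i) = flip_orbit e (barsum (prefix i)).
Proof.
by case/andP=> i0 i4; rewrite (flip_orbit_class i4) // card_prefix ?mem_Aset //; lia.
Qed.

Lemma eq_weight_part (i j : nat) : (0 < i <= 4)%N -> (0 < j <= 4)%N ->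
  (weight_part e (Uspan e) (Aset e i) == weight_part e (Uspan e) (Aset e j)) =
    (i == j) || (i + j == n + p %[mod 4])%N.
Proof.
move=> i4 j4; have cardP : #|prefix i| = i by rewrite card_prefix; lia.
apply/eqP/idP => [eq_ij|ij].
  have := flip_orbit_refl e (barsum (prefix i)).
  rewrite -weight_part_orbit // eq_ij in_weight_part cardP mem_Aset; lia.
rewrite weight_part_orbit // (@flip_orbit_class j) // ?cardP ?mem_Aset; lia.
Qed.

Lemma flip_orbit0 : flip_orbit e 0 = [set 0].
Proof.
apply/eqP; rewrite eqEsubset sub1set flip_orbit_refl andbT.
by apply: flip_orbit_sub => [s v|]; rewrite !inE // => /eqP->; rewrite mulmx0.
Qed.

Lemma weight_part_without0 (i : nat) : (i <= 4)%N ->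
  0 \notin weight_part e (Uspan e) (Aset e i).
Proof. by move=> i4; rewrite -barsum0 in_weight_part cards0 mem_Aset. Qed.

Lemma orbitsP (O : {set vec}) :
  reflect (O = [set 0] \/
    exists2 i, (0 < i <= 4)%N & O = weight_part e (Uspan e) (Aset e i))
    (O \in orbits e).
Proof.
apply: (iffP imsetP) => [[u _ ->]|[->|[i i4 ->]]]; last 2 first.
- by exists 0; rewrite ?inE ?flip_orbit0.
- by exists (barsum (prefix i)); rewrite ?inE ?weight_part_orbit.
have [D ->] := barsum_surj u; have [->|/set0Pn/card_gt0P D0] := eqVneq D set0.
  by left; rewrite barsum0 flip_orbit0.
have le_Dn : (#|D| <= n)%N by rewrite (leq_trans (max_card _)) ?card_ord.
pose w := (if #|D| %% 4 == 0 then 4 else #|D| %% 4)%N.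
have w4 : (0 < w <= 4)%N by rewrite /w; case: ifP; lia.
case/andP: (w4) => w_gt0 w_le4.
right; exists w; rewrite // (@flip_orbit_class w) ?mem_Aset //.
by move: w4; rewrite /w; case: ifP; lia.
Qed.

(** * Hamming weights and the set [Iset] *)

Lemma hamming0 : hamming (0 : vec) = 0%N.
Proof. by apply: eq_card0 => a; rewrite inE mxE eqxx. Qed.

Lemma hamming_tilde (a : 'I_n) : hamming (tilde a) = 1%N.
Proof.
rewrite /hamming -[RHS](cards1 a); apply: eq_card => b.
by rewrite !inE mxE; case: (b == a).
Qed.

Lemma hamming_gt0 (u : vec) : u != 0 -> (0 < hamming u)%N.
Proof.
apply: contraNltn; rewrite leqn0 cards_eq0 => /eqP/setP u0; apply/eqP/colP=> a.
by have := u0 a; rewrite !inE mxE => /negbFE/eqP.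
Qed.

Lemma F2_bool (x : 'F_2) : x = (x != 0)%:R.
Proof. by case: x => [[|[|//]] //= lt_x]; apply: val_inj. Qed.

Lemma hamming1P (u : vec) : hamming u = 1%N -> exists a, u = tilde a.
Proof.
move/eqP/cards1P=> [a /setP ua]; exists a; apply/colP=> b.
by have := ua b; rewrite !inE mxE => <-; apply: F2_bool.
Qed.

(** The path parts telescope. *)
Lemma barsum_prefix (k : nat) : (0 < k <= n')%N ->
  barsum (prefix k) = tilde (vtx n' k) + (odd #|prefix k :&: hubset|)%:R *: tilde ord_max.
Proof.
case/andP=> k_gt0 le_kn; apply/colP=> a; rewrite !mxE.
have kE : vtx n' k = k.-1 :> nat by rewrite inord_path //; lia.
case: (ltnP a n') => [an|na].
  have -> : (a == ord_max) = false by rewrite -val_eqE /=; lia.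
  rewrite barsum_path // mulr0 addr0 !inE inordK // -val_eqE /= kE.
  by congr (nat_of_bool _)%:R; lia.
have -> : a = ord_max by apply: hub_coord; rewrite ltnNge na.
rewrite barsum_hub eqxx mulr1; have -> : (ord_max == vtx n' k) = false.
  by rewrite -val_eqE [val (vtx n' k)]kE /=; lia.
by rewrite add0r.
Qed.

(** Each path coordinate is counted twice, and the s_n coordinate is the parity of [#|hubset|].
    Hence complementing an index set changes only the s_n coordinate. *)
Lemma barsum_setT : barsum [set: 'I_n] = tilde ord_max.
Proof.
apply/colP=> a; rewrite mxE; case: (ltnP a n') => [an|na].
  by rewrite barsum_path // !inE -val_eqE /= ltn_eqF.
have -> : a = ord_max by apply: hub_coord; rewrite ltnNge na.
by rewrite barsum_hub setTI hub_odd eqxx.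
Qed.

Lemma barsum_setC (D : {set 'I_n}) : barsum (~: D) = barsum D + tilde ord_max.
Proof.
rewrite -barsum_setT /barsum [in X in _ + X](big_setID D) /= setTI setTD addrA.
by rewrite -/(barsum D) addrr_F2 add0r.
Qed.

Lemma prefix_n : prefix n = [set: 'I_n].
Proof. by apply/setP=> i; rewrite !inE ltn_ord. Qed.

Lemma hamming_prefix (k : nat) : (0 < k <= n)%N -> (hamming (barsum (prefix k)) <= 2)%N.
Proof.
case/andP=> k_gt0; rewrite leq_eqVlt ltnS => /predU1P[->|le_kn].
  by rewrite prefix_n barsum_setT hamming_tilde.
rewrite barsum_prefix ?k_gt0 //.
apply: (@leq_trans #|[set vtx n' k; ord_max]|); last by rewrite cards2; case: (_ != _).
apply: subset_leq_card; apply/subsetP=> a; rewrite !inE !mxE.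
by case: (a == vtx n' k) => //; case: (a == ord_max); rewrite //= mulr0 addr0 eqxx.
Qed.

Lemma mem_Iset (i : nat) :
  (i \in Iset e) = (0 < i <= n)%N && [|| ~~ odd #|prefix i :&: hubset|, i == n
    | odd #|prefix (n - i) :&: hubset|].
Proof.
rewrite mem_filter mem_iota add1n ltnS andbC.
case/boolP: (0 < i <= n)%N => //= /andP[_ le_in].
by rewrite !card_prefix_set // leq_subr.
Qed.

(** The three clauses of [Iset] match the three forms of [D]: a prefix with even hub part, the full
    set (for tilde s_n), and the complement of a prefix with odd hub part. *)
Lemma hamming1_Iset (D : {set 'I_n}) : hamming (barsum D) = 1%N -> #|D| \in Iset e.
Proof.
case/hamming1P=> a Da; rewrite mem_Iset; have [an|na] := ltnP a n'; last first.
  have aE : a = ord_max by apply: hub_coord; rewrite ltnNge na.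
  move: Da; rewrite aE -barsum_setT => /barsum_inj->.
  by rewrite cardsT card_ord eqxx leqnn orbT.
have aE : vtx n' a.+1 = a by rewrite /vtx inord_val.
have := @barsum_prefix a.+1 an; rewrite aE.
have [oddP|evenP] := boolP (odd _); last first.
  rewrite scale0r addr0 -Da => /barsum_inj <-; rewrite card_prefix ?evenP; lia.
rewrite scale1r => /(congr1 (fun u => u + tilde ord_max)).
rewrite -barsum_setC -addrA addrr_F2 addr0 -Da => /barsum_inj <-.
have -> : #|~: prefix a.+1| = (n - a.+1)%N.
  by rewrite cardsCs setCK card_ord card_prefix //; lia.
rewrite subKn ?oddP; lia.
Qed.

Lemma Iset_hamming1 (i : nat) : i \in Iset e ->
  exists2 D : {set 'I_n}, #|D| = i & hamming (barsum D) = 1%N.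
Proof.
rewrite mem_Iset => /andP[/andP[i0 le_in]].
have [->|ne_in] := eqVneq i n.
  by exists (prefix n); rewrite ?card_prefix // prefix_n barsum_setT hamming_tilde.
case/orP=> [evenP|/= oddP].
  exists (prefix i); first exact: card_prefix.
  by rewrite barsum_prefix ?(negPf evenP) ?scale0r ?addr0 ?hamming_tilde //; lia.
exists (~: prefix (n - i)); first by rewrite cardsCs setCK card_ord card_prefix; lia.
rewrite barsum_setC barsum_prefix; last by lia.
by rewrite oddP scale1r -addrA addrr_F2 addr0 hamming_tilde.
Qed.

Lemma orbit_weight_le (O : {set vec}) (u : vec) : u \in O ->
  (orbit_weight O <= hamming u)%N.
Proof. exact: (@Order.TotalTheory.bigmin_le_cond _ nat). Qed.

Lemma orbit_weight_ge (O : {set vec}) (k : nat) : (k <= n)%N ->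
  (forall u, u \in O -> (k <= hamming u)%N) -> (k <= orbit_weight O)%N.
Proof. by move=> le_kn Ok; apply: (@Order.POrderTheory.le_bigmin _ nat). Qed.

Lemma orbit_weight0 : orbit_weight [set (0 : vec)] = 0%N.
Proof.
by apply/eqP; rewrite -leqn0 (leq_trans (orbit_weight_le (set11 0))) ?hamming0. Qed.

(** The class omits 0, contains a vector of weight 1 exactly when its sizes meet [Iset e], and
    always contains [barsum (prefix i)], of weight at most 2. *)
Lemma orbit_weight_part (i : nat) : (0 < i <= 4)%N ->
  orbit_weight (weight_part e (Uspan e) (Aset e i)) =
    (if has [in Iset e] (Aset e i) then 1 else 2)%N.
Proof.
case/andP=> i0 i4; set O := weight_part _ _ _.
have Opos u : u \in O -> (0 < hamming u)%N.
  move=> uO; apply: hamming_gt0.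
  by apply: contraTneq uO => ->; apply: weight_part_without0.
apply/eqP; rewrite eqn_leq.
case: ifPn => [/hasP[j jA /Iset_hamming1[D cardD Dham]]|/hasPn noI].
  rewrite orbit_weight_ge // andbT; apply: leq_trans (orbit_weight_le _) (eq_leq Dham).
  by rewrite in_weight_part cardD.
apply/andP; split.
  apply: leq_trans (hamming_prefix (k := i) _); last by lia.
  by rewrite orbit_weight_le // in_weight_part card_prefix ?mem_Aset //; lia.
apply: orbit_weight_ge => [|u uO]; first by lia.
rewrite ltn_neqAle Opos // andbT eq_sym; apply/eqP=> u1.
have [D uD] := barsum_surj u; move: uO; rewrite uD in_weight_part => /noI /negP; apply.
by apply: hamming1_Iset; rewrite -uD.
Qed.

(** * The maximal orbit weight and the number of orbits *)

Lemma max_orbit_weightE :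
  max_orbit_weight e =
    (if all (fun i => has [in Iset e] (Aset e i)) (iota 1 4) then 1 else 2)%N.
Proof.
have le_max i : (0 < i <= 4)%N ->
    ((if has [in Iset e] (Aset e i) then 1 else 2) <= max_orbit_weight e)%N.
  move=> i4; rewrite -orbit_weight_part //; apply: leq_bigmax_cond.
  by apply/orbitsP; right; exists i.
have max_le m : (forall i, (0 < i <= 4)%N ->
    (if has [in Iset e] (Aset e i) then 1 else 2) <= m)%N -> (max_orbit_weight e <= m)%N.
  move=> Hm; apply/bigmax_leqP=> O /orbitsP[->|[i i4 ->]]; first by rewrite orbit_weight0.
  by rewrite orbit_weight_part // Hm.
apply/eqP; rewrite eqn_leq; case: ifPn => [/allP allI|/allPn[i]].
  apply/andP; split; first by apply: max_le => i i4; rewrite allI // mem_iota.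
  by apply: leq_trans (le_max 1%N isT); case: ifP.
rewrite mem_iota => i4 noI; have := le_max i i4; rewrite (negPf noI) => ->.
by rewrite andbT; apply: max_le => j _; case: ifP.
Qed.

Lemma orbitsE :
  orbits e :\ [set 0] =
    [set weight_part e (Uspan e) (Aset e 1); weight_part e (Uspan e) (Aset e 2);
         weight_part e (Uspan e) (Aset e 3); weight_part e (Uspan e) (Aset e 4)].
Proof.
have ne0 i : (i <= 4)%N -> weight_part e (Uspan e) (Aset e i) != [set 0].
  move=> i4; apply: contraNneq (weight_part_without0 i4) => ->; exact: set11.
apply/setP=> O; rewrite in_setD1 !in_setU !in_set1; apply/andP/idP.
  case=> O0 /orbitsP[/eqP|[i]]; first by rewrite (negPf O0).
  by case: i => [|[|[|[|[|//]]]]] // _ ->; rewrite eqxx ?orbT.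
move=> O4; suff [i i4 ->] :
    exists2 i, (0 < i <= 4)%N & O = weight_part e (Uspan e) (Aset e i).
  by split; [apply: ne0; case/andP: i4 | apply/orbitsP; right; exists i].
by case/orP: O4 => [/orP[/orP[]|]|] /eqP->; [exists 1%N|exists 2%N|exists 3%N|exists 4%N].
Qed.

(** The involution sending [i] to [n + p - i] identifies residues modulo 4. For [n] odd, [n + p] is
    even and there are two fixed residues and one pair; for [n] even there are two pairs. The
    trivial orbit adds one. *)
Lemma card_orbits : #|orbits e| = (if odd n then 4 else 3)%N.
Proof.
rewrite (cardsD1 [set 0]) (introT (orbitsP _)); last by left.
rewrite orbitsE -!setUA !cardsU1 cards1 !in_setU1 !in_set1 !eq_weight_part //.
have -> : odd n = ~~ odd ((n + p) %% 4)%N by move: hub_odd; lia.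
by case: ((n + p) %% 4)%N (ltn_pmod (n + p) (isT : 0 < 4)%N) => [|[|[|[|]]]].
Qed.

End PathBasis.

Theorem theorem5p3 (n' : nat) (e : rel 'I_n'.+1)
    (n_ge2 : (2 <= n'.+1)%N)
    (e_simple : simple_graph e)
    (e_connected : connected_graph e)
    (e_path : induced_path e)
    (Pi1_odd : odd #|Pi1 e|)
    (Pi1_ge3 : (3 <= #|Pi1 e|)%N)
    (Pi1_le : (#|Pi1 e| <= n'.+1 - 3)%N) :
  [/\ orbits e :\ [set 0] =
        [set weight_part e (Uspan e) (Aset e 1); weight_part e (Uspan e) (Aset e 2);
             weight_part e (Uspan e) (Aset e 3); weight_part e (Uspan e) (Aset e 4)],
      #|orbits e| = (if odd n'.+1 then 4 else 3)%N
    & max_orbit_weight e =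
        (if all (fun i => has [in Iset e] (Aset e i)) (iota 1 4) then 1 else 2)%N].
Proof.
(* The two bounds on [#|Pi1 e|] force at least six vertices. *)
have n'_gt1 : (1 < n')%N by lia.
rewrite card_Pi1 // in Pi1_odd Pi1_ge3 Pi1_le.
by split; [apply: orbitsE | apply: card_orbits | apply: max_orbit_weightE].
Qed.
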